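(* Let $D\subset\mathbb{C}^n$ be a (Kobayashi) hyperbolic domain with finite Euclidean volume, endowed with the distance $\rho_D=\tanh k_D$, where $k_D$ is the Kobayashi distance. Let $\Gamma=\{z_j\}\subset D$ be a uniformly discrete sequence with $d(z_j,\partial D)<1$ for all $z_j\in\Gamma$. Then $$\sum_{z_j\in\Gamma} d(z_j,\partial D)^{2n}\, h\left(-\frac{1}{\log d(z_j,\partial D)}\right)<+\infty$$ for any increasing function $h\colon\mathbb{R}^+\to\mathbb{R}^+$ such that $$\sum_{m=1}^{+\infty}h\left(\frac{1}{m}\right)<+\infty.$$
   Context: A domain is a connected open set; $d(\cdot,\partial D)$ is the Euclidean distance from the boundary of $D$, and $\mathbb{R}^+=[0,+\infty)$. Kobayashi distance: let $k_\Delta(\zeta,\eta)=\tanh^{-1}\left|\frac{\zeta-\eta}{1-\overline{\eta}\zeta}\right|$ be the Poincaré distance of the unit disk $\Delta\subset\mathbb{C}$. The Lempert function of $D$ is $\delta_D(z,w)=\inf\{k_\Delta(\zeta,\eta)\mid \exists\,\phi\colon\Delta\to D \text{ holomorphic}, \phi(\zeta)=z, \phi(\eta)=w\}$, and the Kobayashi pseudodistance $k_D$ is the largest pseudodistance on $D$ bounded above by $\delta_D$. $D$ is (Kobayashi) hyperbolic if $k_D$ is a true distance; then $\rho_D=\tanh k_D$ is also a distance. A sequence $\{x_j\}$ in a metric space $(X,d)$ is uniformly discrete if there is $\delta>0$ such that $d(x_j,x_k)\ge\delta$ for all $j\ne k$. *)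

(* Defs.v *)
From HB Require Import structures.
From mathcomp Require Import all_boot all_order all_algebra.
From mathcomp Require Import complex.
From mathcomp Require Import all_classical all_reals all_analysis.
From mathcomp Require Import ring.

Set Implicit Arguments.
Unset Strict Implicit.
Unset Printing Implicit Defensive.

Import Order.TTheory GRing.Theory Num.Theory.
Import numFieldNormedType.Exports.
Import Normc.

Local Open Scope classical_set_scope.
Local Open Scope complex_scope.
Local Open Scope ring_scope.

(* [R[i]^o] is [R[i]] with the topology and the normed [R[i]]-module structure
   given by the modulus. *)
Notation Cn R n := 'rV[R[i]^o]_n.

Section Tanh.
Context {R : realType}.

Definition tanh (x : R) : R :=
  (expR x - expR (- x)) / (expR x + expR (- x)).

Definition artanh (t : R) : R := ln ((1 + t) / (1 - t)) / 2.

Lemma tanhK : cancel tanh artanh.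
Proof.
move=> x; rewrite /artanh /tanh expRN; set a := expR x.
have a0 : 0 < a := expR_gt0 x.
have aa : a * a + 1 != 0 by rewrite gt_eqF // addr_gt0 ?mulr_gt0.
have -> : (1 + (a - a^-1) / (a + a^-1)) / (1 - (a - a^-1) / (a + a^-1)) = a * a.
  field; rewrite (lt0r_neq0 a0) aa /= [X in X != 0](_ : _ = 2) ?pnatr_eq0 //; ring.
by rewrite lnM ?posrE // expRK; field.
Qed.

Lemma artanhK : {in `]-1, 1[, cancel artanh tanh}.
Proof.
move=> t; rewrite in_itv /= => /andP[t1 t2].
have p0 : 0 < 1 + t by rewrite -ltrBlDl sub0r.
have m0 : 0 < 1 - t by rewrite subr_gt0.
set u := artanh t.
have u2 : expR u * expR u = (1 + t) / (1 - t).
  by rewrite -expRD /u /artanh -splitr lnK // posrE divr_gt0.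
have e0 : expR u != 0 by rewrite gt_eqF ?expR_gt0.
have -> : tanh u = (expR u * expR u - 1) / (expR u * expR u + 1).
  rewrite /tanh expRN; field.
  by rewrite e0 andbT gt_eqF // addr_gt0 // mulr_gt0 ?expR_gt0.
rewrite u2; field.
by rewrite (lt0r_neq0 m0) /= [X in X != 0](_ : _ = 2) ?pnatr_eq0 //; ring.
Qed.

End Tanh.

Section Kobayashi.
Context {R : realType} {n : nat}.

Definition domain (D : set (Cn R n)) := open D /\ connected D.

Definition unit_disk : set R[i]^o := [set zeta | normc zeta < 1].

Definition poincare_distance (zeta eta : R[i]) : R :=
  artanh (normc ((zeta - eta) / (1 - eta^* * zeta))).

(* Limits of difference quotients are taken over [R[i]], so derivability in the
   direction 1 is complex differentiability. *)
Definition holomorphic_disk (D : set (Cn R n)) (phi : R[i]^o -> Cn R n) :=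
  forall zeta, unit_disk zeta -> derivable phi zeta 1 /\ D (phi zeta).

(* The value is [+oo] when no holomorphic disk in D passes through z and w. *)
Definition lempert (D : set (Cn R n)) (z w : Cn R n) : \bar R :=
  ereal_inf [set r | exists zeta eta phi,
    [/\ unit_disk zeta, unit_disk eta, holomorphic_disk D phi,
        phi zeta = z /\ phi eta = w & r = (poincare_distance zeta eta)%:E]].

Definition pseudodistance_on (D : set (Cn R n)) (p : Cn R n -> Cn R n -> R) :=
  [/\ forall z w, D z -> D w -> 0 <= p z w,
      forall z, D z -> p z z = 0,
      forall z w, D z -> D w -> p z w = p w z
    & forall x y z, D x -> D y -> D z -> p x z <= p x y + p y z].

Definition distance_on (D : set (Cn R n)) (p : Cn R n -> Cn R n -> R) :=
  pseudodistance_on D p /\ forall z w, D z -> D w -> p z w = 0 -> z = w.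

(* The largest pseudodistance below the Lempert function, as a pointwise
   supremum; chains of holomorphic disks make it finite when D is a domain. *)
Definition kobayashi (D : set (Cn R n)) (z w : Cn R n) : R :=
  sup [set p z w | p in [set p | pseudodistance_on D p /\
    forall x y, D x -> D y -> ((p x y)%:E <= lempert D x y)%E]].

Definition hyperbolic (D : set (Cn R n)) := distance_on D (kobayashi D).

Definition rho (D : set (Cn R n)) (z w : Cn R n) : R := tanh (kobayashi D z w).

(* The library norm on ['rV_n] is the sup norm. *)
Definition euclidean_norm (z : Cn R n) : R :=
  Num.sqrt (\sum_(j < n) normc (z ord0 j) ^+ 2).

Definition boundary (D : set (Cn R n)) := closure D `\` interior D.

(* Meaningful when the boundary is nonempty ([inf set0 = 0]), which is the case
   for a nonempty hyperbolic domain in positive dimension. *)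
Definition dist_boundary (D : set (Cn R n)) (z : Cn R n) : R :=
  inf [set euclidean_norm (z - x) | x in boundary D].

End Kobayashi.

Definition uniformly_discrete {R : realType} {T : Type} (d : T -> T -> R)
    (x : nat -> T) :=
  exists2 delta : R, 0 < delta & forall j k, j != k -> delta <= d (x j) (x k).

(* Lebesgue measure on R^2n = (..((R * R) * R) * ..) as an iterated product
   measure; [coordinates] identifies C^n with R^2n. *)
Section Volume.
Context (R : realType).

Fixpoint R2n_display (n : nat) : measure_display :=
  if n is n'.+1 then
    measure_prod_display
      (measure_prod_display
        (R2n_display n', sigma_display R.-ocitv.-measurable),
       sigma_display R.-ocitv.-measurable)
  else default_measure_display.

Fixpoint R2n (n : nat) : measurableType (R2n_display n) :=
  match n return measurableType (R2n_display n) with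
  | 0 => unit
  | n'.+1 => (R2n n' * measurableTypeR R * measurableTypeR R)%type
  end.

Fixpoint lebesgue_R2n (n : nat) : {measure set (R2n n) -> \bar R} :=
  match n return {measure set (R2n n) -> \bar R} with
  | 0 => \d_tt : {measure set unit -> \bar R}
  | n'.+1 => ((lebesgue_R2n n' \x lebesgue_measure) \x lebesgue_measure)%E
      : {measure set (R2n n' * measurableTypeR R * measurableTypeR R)%type
           -> \bar R}
  end.

Fixpoint coordinates (n : nat) : Cn R n -> R2n n :=
  match n return Cn R n -> R2n n with
  | 0 => fun=> tt
  | n'.+1 => fun z =>
      (coordinates (\row_(j < n') z ord0 (widen_ord (leqnSn n') j)),
       complex.Re (z ord0 ord_max), complex.Im (z ord0 ord_max))
  end.

Definition volume (n : nat) (D : set (Cn R n)) : \bar R :=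
  lebesgue_R2n n (@coordinates n @` D).

End Volume.

(* Main.v *)
Require Import Defs.
From mathcomp Require Import all_boot all_order all_algebra.
From mathcomp Require Import complex.
From mathcomp Require Import all_classical all_reals all_analysis.
From mathcomp Require Import ring lra.

Set Implicit Arguments.
Unset Strict Implicit.
Unset Printing Implicit Defensive.

Import Order.TTheory GRing.Theory Num.Theory.
Import numFieldNormedType.Exports.

Local Open Scope classical_set_scope.
Local Open Scope ring_scope.

(** Write d(z) for the distance from z to the boundary of D.  The theorem holds
    because the Kobayashi balls of a fixed small radius around the points z_j
    are pairwise disjoint and each of them contains a Euclidean ball of radius
    comparable with d(z_j), so that the finite volume of D bounds the sum of
    the d(z_j)^(2n).

    The Euclidean ball of radius d(z) around z lies in D
    ([ball_dist_boundary]): a segment from z to a point outside D meets the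
    boundary.  Hence zeta |-> z + zeta (w - z) / c maps the unit disk into D as
    soon as |w - z| <= c d(z) with 0 < c < 1; it sends 0 to z and c to w, so
    k_D(z, w) <= artanh c ([kobayashi_le_artanh]).  Separation by delta in
    rho_D = tanh k_D is separation by kappa = artanh delta in k_D.  With
    c = tanh (kappa / 3), the triangle inequality for k_D keeps the Euclidean
    balls of radius c d(z_j) around the z_j disjoint.

    Volumes are compared through cubes of R^2n inside these balls, since the
    volume of a cube is read off the iterated product measure
    ([volume_cube], [sum_cubes_le_volume]).  This gives the finiteness of the
    sum of the d(z_j)^(2n) ([sum_dist_boundary_lty]).

    Finally the weights h (- 1 / ln d(z_j)) are bounded
    ([weighted_sum_lty]): since d(z_j) tends to 0, all but finitely many j
    satisfy d(z_j) < 1/e, where the weight is at most h 1. *)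

(** * Cubes of R^2n and the volume of open sets *)

Section Cubes.
Context {R : realType}.

Lemma measurable_real_ball (x r : R) :
  measurable (ball x r : set (measurableTypeR R)).
Proof. by rewrite ball_itv; exact: measurable_itv. Qed.

Lemma normc_le_ReIm (x : R[i]) :
  Normc.normc x <= `|complex.Re x| + `|complex.Im x|.
Proof.
case: x => a b /=; rewrite -[leRHS]ger0_norm ?addr_ge0 // -sqrtr_sqr.
rewrite ler_sqrt ?sqr_ge0 // -(real_normK (num_real a)) -(real_normK (num_real b)).
by have := normr_ge0 a; have := normr_ge0 b; nra.
Qed.

(** The open sup-norm ball of R^2n rather than of C^n: its image under
    [coordinates] is a product of intervals. *)
Definition cube n (z : Cn R n) (r : R) : set (Cn R n) :=
  [set w | forall j, ball (complex.Re (z ord0 j)) r (complex.Re (w ord0 j)) /\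
                     ball (complex.Im (z ord0 j)) r (complex.Im (w ord0 j))].

Lemma coordinates_inj n : injective (@coordinates R n).
Proof.
elim: n => [z w _|n IHn z w /= [/IHn + re im]].
  by apply/rowP => -[].
move=> /rowP zw; apply/rowP => j; case: (unliftP ord_max j) => [i|] ->.
  have := zw i; rewrite !mxE.
  by have -> : widen_ord (leqnSn n) i = lift ord_max i
    by apply: val_inj; rewrite /= /bump leqNgt ltn_ord.
by apply/eqP; rewrite eq_complex re im !eqxx.
Qed.

(** The induction step of every computation with [coordinates], which splits off
    the last complex coordinate. *)
Lemma coordinates_cubeS n (z : Cn R n.+1) (r : R) :
  @coordinates R n.+1 @` cube z r =
  (@coordinates R n @` cube (\row_j z ord0 (widen_ord (leqnSn n) j)) r
     `*` ball (complex.Re (z ord0 ord_max)) r)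
     `*` ball (complex.Im (z ord0 ord_max)) r.
Proof.
apply/seteqP; split => [_ [w zw <-]|].
  have [re im] := zw ord_max; split => //=; split => //=.
  by eexists; last reflexivity; move=> j; rewrite !mxE; exact: zw.
move=> [[_ x] y] [[[w zw /= <-] xz] yz].
have widen (j : 'I_n) : widen_ord (leqnSn n) j = lift ord_max j.
  by apply: val_inj; rewrite /= /bump leqNgt ltn_ord.
exists (\row_j if unlift ord_max j is Some i then w ord0 i else Complex x y).
  move=> j; rewrite !mxE; case: unliftP => [i|] -> //=.
  by have := zw i; rewrite !mxE widen.
rewrite /= !mxE unlift_none /=; congr (_, _, _); congr (coordinates _).
by apply/rowP => j; rewrite !mxE widen liftK.
Qed.

Lemma measurable_cube n (z : Cn R n) r :
  measurable (@coordinates R n @` cube z r).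
Proof.
elim: n z => [|n IHn] z //.
rewrite coordinates_cubeS; apply: measurableX; last exact: measurable_real_ball.
by apply: measurableX; [exact: IHn|exact: measurable_real_ball].
Qed.

Lemma volume_cube n (z : Cn R n) r : 0 <= r ->
  volume (cube z r) = ((r *+ 2) ^+ (2 * n))%:E.
Proof.
move=> r0; rewrite /volume; elim: n z => [|n IHn] z.
  by rewrite muln0 expr0 /= diracE mem_set //; exists z => //; case.
rewrite coordinates_cubeS /=.
have mb := measurable_real_ball ^~ r.
rewrite [LHS](@product_measure1E _ _ _ _ R _ lebesgue_measure)//; last first.
  by apply: measurableX => //; exact: measurable_cube.
rewrite [X in (X * _)%E](@product_measure1E _ _ _ _ R _ lebesgue_measure)//;
  last exact: measurable_cube.
rewrite IHn.
transitivity (((r *+ 2) ^+ (2 * n))%:E * (r *+ 2)%:E * (r *+ 2)%:E)%E.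
  by congr (_ * _ * _)%E; exact: lebesgue_measure_ball.
by rewrite -!EFinM mulnS addnC exprD expr2 mulrA.
Qed.

Lemma open_cube n (D : set (Cn R n)) z : open D -> D z ->
  exists2 e, 0 < e & cube z e `<=` D.
Proof.
move=> oD Dz; have /nbhs_ballP[e e0 eD] : nbhs z D by exact: open_nbhs_nbhs.
move: e0; rewrite /= ltcE /= => /andP[/eqP ime ree].
exists (complex.Re e / 2); first exact: divr_gt0.
move=> w zw; apply: eD; split; first by rewrite ltcE /= ime eqxx.
move=> i j; rewrite (ord1 i) -ball_normE /= normc_def ltcE /= ime eqxx /=.
have [] := zw j; rewrite -!ball_normE /= => zw1 zw2.
have := normc_le_ReIm (z ord0 j - w ord0 j).
by case: (z _ _) (w _ _) zw1 zw2 => [a b] [c d] /=; lra.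
Qed.

(** An open set is the union of the cubes with rational centre and rational
    radius that it contains, and these are countably many. *)
Lemma measurable_coordinates_open n (D : set (Cn R n)) :
  open D -> measurable (@coordinates R n @` D).
Proof.
move=> oD.
pose c (q : 'rV[rat * rat]_n) : Cn R n :=
  \row_j Complex (ratr (q ord0 j).1) (ratr (q ord0 j).2).
pose Q (q : 'rV[rat * rat]_n * rat) := cube (c q.1) (ratr q.2).
suff -> : D = \bigcup_(q in [set q | Q q `<=` D]) Q q.
  rewrite image_bigcup bigcup_mkcond; apply: countable_bigcupT_measurable => //.
  by move=> q; case: ifP => // _; exact: measurable_cube.
apply/seteqP; split => [w Dw|w [q qD qw]]; last exact: qD.
have [e e0 eD] := open_cube oD Dw.
(* A cube of radius r < e / 2 that contains w stays within e of w. *)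
have [r /[!in_itv]/= /andP[r0 re]] :=
  @rat_in_itvoo R 0 (e / 2) (divr_gt0 e0 (ltr0Sn _ _)).
have approx (x : R) : {q : rat | `|ratr q - x| < ratr r}.
  apply: cid.
  have [|q] := @rat_in_itvoo R (x - ratr r) (x + ratr r); first lra.
  by rewrite in_itv /= => qx; exists q; rewrite ltr_distl.
pose q : 'rV[rat * rat]_n := \row_j
  (sval (approx (complex.Re (w ord0 j))), sval (approx (complex.Im (w ord0 j)))).
exists (q, r); last first.
  move=> j; rewrite !mxE /=.
  by split; rewrite -ball_normE /=; exact: (svalP (approx _)).
move=> v /= qv; apply: eD => j.
have [] := qv j; rewrite !mxE /= -!ball_normE /=.
have := svalP (approx (complex.Re (w ord0 j))).
have := svalP (approx (complex.Im (w ord0 j))).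
rewrite !ltr_distl => /andP[? ?] /andP[? ?] /andP[? ?] /andP[? ?].
split; apply/andP; split; lra.
Qed.

End Cubes.

(** * Hyperbolic tangent *)

Section Hyperbolic_tangent.
Context {R : realType}.
Implicit Types t x : R.

Lemma tanh_lt1 x : tanh x < 1.
Proof.
rewrite /tanh; have p := expR_gt0 x; have m := expR_gt0 (- x).
by rewrite ltr_pdivrMr ?mul1r; lra.
Qed.

Lemma tanh_gt0 x : 0 < x -> 0 < tanh x.
Proof.
move=> x0; rewrite /tanh; apply: divr_gt0; last by rewrite addr_gt0 ?expR_gt0.
by rewrite subr_gt0 ltr_expR; lra.
Qed.

Lemma artanh_gt0 t : 0 < t < 1 -> 0 < artanh t.
Proof.
move=> /andP[t0 t1]; rewrite /artanh divr_gt0 // ln_gt0 // ltr_pdivlMr; lra.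
Qed.

Lemma le_artanh s t : 0 <= s -> s <= t -> t < 1 -> artanh s <= artanh t.
Proof.
move=> s0 st t1; rewrite /artanh ler_pM2r ?invr_gt0 //.
rewrite ler_ln ?posrE ?divr_gt0 //; try lra.
rewrite ler_pdivrMr; last lra.
rewrite mulrAC ler_pdivlMr; last lra.
nra.
Qed.

End Hyperbolic_tangent.

(** * Distance from the boundary and Kobayashi distance *)

Section Geometry.
Context {R : realType} {n : nat}.
Implicit Types (D : set (Cn R n)) (z w v : Cn R n).

Lemma euclidean_norm_ge0 v : 0 <= euclidean_norm v.
Proof. exact: sqrtr_ge0. Qed.

Lemma normc_real (t : R) : Normc.normc (real_complex R t) = `|t|.
Proof. by rewrite /= expr0n addr0 sqrtr_sqr. Qed.

Lemma euclidean_normZ (a : R[i]) v :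
  euclidean_norm (a *: v) = Normc.normc a * euclidean_norm v.
Proof.
have a0 : 0 <= Normc.normc a by case: a => ? ?; exact: sqrtr_ge0.
rewrite /euclidean_norm -[X in X * _](ger0_norm a0) -sqrtr_sqr.
rewrite -sqrtrM ?sqr_ge0 //.
congr Num.sqrt; rewrite mulr_sumr; apply: eq_bigr => j _.
by rewrite mxE Normc.normcM exprMn.
Qed.

(** Each complex coordinate has modulus at most 2 r, whence the norm is at most
    2 r sqrt n; the cruder factor n avoids a square root. *)
Lemma euclidean_norm_cube z w (r : R) : 0 <= r -> cube z r w ->
  euclidean_norm (w - z) <= 2 * n%:R * r.
Proof.
move=> r0 zw; have nr0 : 0 <= 2 * n%:R * r by rewrite !mulr_ge0.
rewrite -[leRHS]ger0_norm // -sqrtr_sqr ler_sqrt ?sqr_ge0 //.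
apply: (@le_trans _ _ (\sum_(j < n) (2 * r) ^+ 2)).
  apply: ler_sum => j _; rewrite ler_sqr ?nnegrE ?mulr_ge0 //; last first.
    by case: (X in Normc.normc X) => ? ?; exact: sqrtr_ge0.
  apply: (le_trans (normc_le_ReIm _)); rewrite !mxE.
  have [] := zw j; rewrite -!ball_normE /= => zw1 zw2.
  by move: zw1 zw2; rewrite distrC [in X in _ -> X -> _]distrC;
    case: (z _ _) (w _ _) => [a b] [c d] /=; lra.
rewrite sumr_const card_ord -mulr_natr.
suff : n%:R <= n%:R ^+ 2 :> R by nra.
by rewrite -natrX ler_nat; case: (n) => // m; rewrite expnS expn1 leq_pmulr.
Qed.

Lemma continuous_real_complex :
  continuous (fun t : R => (real_complex R t : R[i]^o)).
Proof.
move=> t; apply/cvgrPdist_lt => e; rewrite ltcE /= => /andP[/eqP ime ree].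
near=> s; rewrite -rmorphB /= normc_def ltcE /= ime eqxx /=.
rewrite expr0n addr0 sqrtr_sqr; near: s; exact: (@cvgr_dist_lt _ _ _ _ _ id).
Unshelve. all: by end_near.
Qed.

(** Otherwise the parameters of the segment that land in D would form a subset
    of [0, 1] that is nonempty, open, and also closed, being the trace of the
    closure of D; so 1 would be one of them. *)
Lemma segment_meets_boundary D z w : open D -> D z -> ~ D w ->
  exists2 t : R, 0 <= t <= 1 & boundary D (z + real_complex R t *: (w - z)).
Proof.
move=> oD Dz Dw.
pose g (t : R) : Cn R n := z + real_complex R t *: (w - z).
have cg : continuous g.
  move=> t; apply: cvgD; first exact: cvg_cst.
  by apply: cvgZr_tmp; exact: continuous_real_complex.
apply: contrapT => noboundary; apply: Dw.
have gD t : 0 <= t <= 1 -> closure D (g t) -> D (g t).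
  move=> t01 cDt; apply: contrapT => Dt; apply: noboundary; exists t => //.
  by split => // /interior_subset.
have segD : `[0 : R, 1]%classic `&` g @^-1` D = `[0 : R, 1]%classic.
  apply: (@segment_connected R 0 1).
  - exists 0; rewrite /= in_itv /= lexx ler01; split => //.
    by rewrite /g rmorph0 scale0r addr0.
  - by exists (g @^-1` D) => //; apply: open_comp => // t _; exact: cg.
  - exists (g @^-1` closure D).
      by apply: preimage_closed; [move=> t _; exact: cg|exact: closed_closure].
    apply/seteqP; split=> t [t01 Dt]; split => //; first exact: subset_closure.
    by apply: gD => //; rewrite /= in_itv in t01.
have : `[0 : R, 1]%classic 1 by rewrite /= in_itv /= lexx ler01.
by rewrite -segD => -[_]; rewrite /= /g rmorph1 scale1r addrC subrK.
Qed.

Lemma dist_boundary_ge0 D z : 0 <= dist_boundary D z.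
Proof.
rewrite /dist_boundary; set S := (X in inf X).
have [->|/set0P ne] := eqVneq S set0; first by rewrite inf0.
by apply: lb_le_inf => // _ [x _ <-]; exact: euclidean_norm_ge0.
Qed.

Lemma ball_dist_boundary D z w : open D -> D z ->
  euclidean_norm (w - z) < dist_boundary D z -> D w.
Proof.
move=> oD Dz; apply: contraPP => Dw; apply/negP; rewrite -leNgt.
have [t /andP[t0 t1] bt] := segment_meets_boundary oD Dz Dw.
apply: (@le_trans _ _ (euclidean_norm (z - (z + real_complex R t *: (w - z))))).
  apply: ge_inf; last by exists (z + real_complex R t *: (w - z)).
  by exists 0 => _ [x _ <-]; exact: euclidean_norm_ge0.
rewrite opprD addNKr -scaleNr -rmorphN euclidean_normZ normc_real normrN.
by rewrite ger0_norm // ler_piMl ?euclidean_norm_ge0.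
Qed.

Lemma derivable_affine z v (a : R[i]^o) :
  derivable (fun zeta : R[i]^o => z + zeta *: v) a 1.
Proof.
apply: (cvgP v); apply: cvg_near_cst.
near=> h; rewrite /= /shift /= opprD addrACA subrr add0r -scalerBl addrK.
rewrite [h%:A]mulr1 scalerA mulVf ?scale1r //; near: h; exact: nbhs_dnbhs_neq.
Unshelve. all: by end_near.
Qed.

(** The affine disk that sends 0 to z and c to w stays in the Euclidean ball of
    radius [dist_boundary D z] around z, so it bounds the Lempert function by the
    Poincare distance from 0 to c. *)
Lemma kobayashi_le_artanh D z w (c : R) : open D -> D z -> 0 < c < 1 ->
  0 < dist_boundary D z ->
  euclidean_norm (w - z) <= c * dist_boundary D z ->
  kobayashi D z w <= artanh c.
Proof.
move=> oD Dz /andP[c0 c1] d0 wz.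
have Dw : D w.
  by apply: (ball_dist_boundary oD Dz); apply: (le_lt_trans wz); rewrite gtr_pMl.
rewrite /kobayashi; set S := (X in sup X).
have [->|/set0P ne] := eqVneq S set0.
  by rewrite sup0; apply/ltW/artanh_gt0; rewrite c0.
apply: ge_sup => // _ [p [_ ple] <-]; rewrite -lee_fin.
apply: (le_trans (ple _ _ Dz Dw)); apply: ereal_inf_lbound.
pose v : Cn R n := real_complex R c^-1 *: (w - z).
exists (real_complex R 0), (real_complex R c), (fun zeta => z + zeta *: v); split.
- by rewrite /unit_disk /mkset normc_real normr0.
- by rewrite /unit_disk /mkset normc_real gtr0_norm.
- move=> zeta zeta1; split; first exact: derivable_affine.
  apply: (ball_dist_boundary oD Dz).
  rewrite addrC addKr scalerA euclidean_normZ Normc.normcM normc_real.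
  rewrite gtr0_norm ?invr_gt0 // -mulrA.
  apply: (@le_lt_trans _ _ (Normc.normc zeta * dist_boundary D z)).
    by rewrite ler_wpM2l ?ler_pdivrMl //; case: (zeta) => ? ?; exact: sqrtr_ge0.
  by rewrite gtr_pMl.
- rewrite rmorph0 scale0r addr0; split => //.
  by rewrite scalerA -rmorphM divff ?gt_eqF //= scale1r addrC subrK.
- rewrite /poincare_distance rmorph0 mulr0 subr0 divr1 sub0r -rmorphN normc_real.
  by rewrite normrN gtr0_norm.
Qed.

End Geometry.

(** * Summation over a uniformly discrete sequence *)

Section Summation.
Context {R : realType}.

Lemma sum_cubes_le_volume n (D : set (Cn R n)) (x : nat -> Cn R n)
    (r : nat -> R) :
  open D -> (forall j, 0 <= r j) -> (forall j, cube (x j) (r j) `<=` D) ->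
  trivIset setT (fun j => cube (x j) (r j)) ->
  (\sum_(0 <= j <oo) ((r j *+ 2) ^+ (2 * n))%:E <= volume D)%E.
Proof.
move=> oD r0 rD triv; pose Q j := @coordinates R n @` cube (x j) (r j).
have mQ j : measurable (Q j) by exact: measurable_cube.
have mUQ : measurable (\bigcup_j Q j) by exact: bigcupT_measurable.
rewrite (eq_eseriesr (g := fun j => lebesgue_R2n R n (Q j))); last first.
  by move=> j _; rewrite -(volume_cube (x j) (r0 j)).
rewrite -(measure_semi_bigcup (lebesgue_R2n R n) mQ) //.
  apply: le_measure; rewrite ?inE //; first exact: measurable_coordinates_open.
  by move=> _ [j _ [w /rD Dw <-]]; exists w.
apply/trivIsetP => i j _ _ ij; apply/seteqP; split => // _ [[w wi <-] [w' wj]].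
move=> /coordinates_inj ww'; rewrite ww' in wj.
move/trivIsetP: triv => /(_ i j I I ij)/seteqP[disj _].
exact: (disj w (conj wi wj)).
Qed.

(** A summable nonnegative sequence stays summable when multiplied by a bounded
    one.  The weights are bounded because the d j tend to 0, and
    - 1 / ln x <= 1 for x < 1/e. *)
Lemma weighted_sum_lty (p : nat) (d : nat -> R) (h : R -> R) :
  (0 < p)%N -> (forall j, 0 <= d j < 1) ->
  (forall x, 0 <= x -> 0 <= h x) ->
  (forall x y, 0 <= x -> x <= y -> h x <= h y) ->
  (\sum_(0 <= j <oo) (d j ^+ p)%:E < +oo)%E ->
  (\sum_(0 <= j <oo) (d j ^+ p * h (- (ln (d j))^-1))%:E < +oo)%E.
Proof.
move=> p0 d01 h0 hi sumd.
have d0 j : 0 <= d j by case/andP: (d01 j).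
have u0 j : 0 <= - (ln (d j))^-1.
  by rewrite oppr_ge0 invr_le0 ln_le0 // ltW //; case/andP: (d01 j).
have dp0 j : 0 <= d j ^+ p by exact: exprn_ge0.
have [N smalld] : exists N, forall j, (N <= j)%N -> d j < expR (-1).
  have /cvgrPdist_lt/(_ (expR (-1) ^+ p)) :=
    cvg_series_cvg_0 (nnseries_is_cvg dp0 sumd).
  case; first by rewrite exprn_gt0 ?expR_gt0.
  move=> N _ smalld; exists N => j /smalld /=.
  rewrite sub0r normrN ger0_norm // ltr_pXn2r // nnegrE //; exact: expR_ge0.
(* Covers the finitely many indices below N and the bound h 1 of the others. *)
pose K := h 1 + \sum_(i < N) h (- (ln (d i))^-1).
have K0 : 0 <= K by rewrite addr_ge0 ?h0 // sumr_ge0 // => i _; exact: h0.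
have hK j : h (- (ln (d j))^-1) <= K.
  have [jN|/smalld dj] := ltnP j N.
    rewrite /K (bigD1 (Ordinal jN)) //= addrCA lerDl addr_ge0 ?h0 //.
    by rewrite sumr_ge0 // => i _; exact: h0.
  rewrite -[leLHS]addr0 lerD //; last by rewrite sumr_ge0 // => i _; exact: h0.
  (* If d j = 0 then ln 0 = 0 and 0^-1 = 0, so the argument of h is 0. *)
  apply: hi => //; move: (d0 j); rewrite le_eqVlt => /predU1P[<-|dj0].
    by rewrite ln0 // invr0 oppr0.
  have ln1 : ln (d j) < -1 by rewrite -[ltRHS]expRK ltr_ln ?posrE ?expR_gt0.
  rewrite -invrN invf_le1; lra.
apply: (@le_lt_trans _ _ (\sum_(0 <= j <oo) (K%:E * (d j ^+ p)%:E))%E).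
  apply: lee_nneseries => [j _ _|j _]; first by rewrite lee_fin mulr_ge0 // h0.
  by rewrite -EFinM lee_fin mulrC ler_wpM2r.
rewrite nneseriesZl; last by move=> j _; rewrite lee_fin.
by rewrite lte_mul_pinfty ?lee_fin.
Qed.

(** Cubes of radius proportional to [dist_boundary D (z j)] lie within Kobayashi
    distance kappa / 3 of z j, where kappa separates the z j, hence they are
    disjoint. *)
Lemma sum_dist_boundary_lty n (D : set (Cn R n)) (z : nat -> Cn R n) :
  (0 < n)%N -> domain D -> hyperbolic D -> (volume D < +oo)%E ->
  (forall j, D (z j)) -> uniformly_discrete (rho D) z ->
  (\sum_(0 <= j <oo) (dist_boundary D (z j) ^+ (2 * n))%:E < +oo)%E.
Proof.
move=> n0 [oD _] [[_ _ ksym ktri] _] volD zD [delta delta0 sep].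
have delta1 : delta < 1 by exact: le_lt_trans (sep 0%N 1%N isT) (tanh_lt1 _).
pose kappa := artanh delta.
have kappa0 : 0 < kappa by apply: artanh_gt0; rewrite delta0.
have ksep i j : i != j -> kappa <= kobayashi D (z i) (z j).
  move=> /sep dij; rewrite -[leRHS]tanhK.
  by apply: le_artanh dij _ => //; [exact: ltW|exact: tanh_lt1].
pose c : R := tanh (kappa / 3).
have c01 : 0 < c < 1 by rewrite tanh_lt1 tanh_gt0 // divr_gt0.
have [c0 c1] := andP c01.
have n0R : 0 < 2 * n%:R :> R by rewrite mulr_gt0 // ltr0n.
(* The factor 2n turns the cube of radius r j into a subset of the Euclidean
   ball of radius c * dist_boundary D (z j). *)
pose r j : R := c / (2 * n%:R) * dist_boundary D (z j).
have r0 j : 0 <= r j by rewrite mulr_ge0 ?dist_boundary_ge0 // divr_ge0 // ltW.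
have close j w : cube (z j) (r j) w -> D w /\ kobayashi D (z j) w <= kappa / 3.
  (* A cube of radius 0 is empty, so z j is at positive distance. *)
  move=> jw; have rj0 : 0 < r j.
    have [+ _] := jw (Ordinal n0); rewrite -ball_normE /=; exact: le_lt_trans.
  have d0 : 0 < dist_boundary D (z j).
    by move: rj0; rewrite pmulr_rgt0 // divr_gt0.
  have wj : euclidean_norm (w - z j) <= c * dist_boundary D (z j).
    have := euclidean_norm_cube (r0 j) jw.
    by rewrite /r mulrA [2 * _ * _]mulrC divfK ?gt_eqF.
  split; last by have := kobayashi_le_artanh oD (zD j) c01 d0 wj; rewrite tanhK.
  apply: (ball_dist_boundary oD (zD j)).
  by apply: (le_lt_trans wj); rewrite gtr_pMl.
have packed : (\sum_(0 <= j <oo) ((r j *+ 2) ^+ (2 * n))%:E < +oo)%E.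
  apply: le_lt_trans volD; apply: sum_cubes_le_volume => //.
    by move=> j w /close[].
  apply/trivIsetP => i j _ _ ij; apply/seteqP; split => // w.
  move=> [/close[Dw iw] /close[_ jw]].
  have := ktri (z i) w (z j) (zD i) Dw (zD j).
  by rewrite [kobayashi D w _]ksym //; have := ksep _ _ ij; lra.
pose b : R := (c / n%:R) ^+ (2 * n).
have b0 : 0 < b by rewrite exprn_gt0 // divr_gt0 // ltr0n.
rewrite (eq_eseriesr
  (g := fun j => (b^-1)%:E * ((r j *+ 2) ^+ (2 * n))%:E)%E); last first.
  move=> j _; rewrite -EFinM; congr (_%:E).
  rewrite (_ : r j *+ 2 = c / n%:R * dist_boundary D (z j)).
    by rewrite exprMn mulrA mulVf ?mul1r // gt_eqF.
  by rewrite /r -mulr_natr; field; rewrite pnatr_eq0 -lt0n.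
rewrite nneseriesZl; last by move=> j _; rewrite lee_fin exprn_ge0 // mulrn_wge0.
by rewrite lte_mul_pinfty ?lee_fin // invr_ge0 ltW.
Qed.

End Summation.

(** * The weighted sum *)

Theorem proposition3p4 (R : realType) (n : nat) (hn : (0 < n)%N)
    (D : set (Cn R n)) (D_domain : domain D) (D_hyperbolic : hyperbolic D)
    (D_volume : (volume D < +oo)%E)
    (z : nat -> Cn R n) (z_in_D : forall j, D (z j))
    (z_discrete : uniformly_discrete (rho D) z)
    (z_near_boundary : forall j, dist_boundary D (z j) < 1)
    (h : R -> R) (h_ge0 : forall x, 0 <= x -> 0 <= h x)
    (h_increasing : forall x y, 0 <= x -> x <= y -> h x <= h y)
    (h_summable : (\sum_(1 <= m <oo) (h m%:R^-1)%:E < +oo)%E) :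
  (\sum_(0 <= j <oo)
     (dist_boundary D (z j) ^+ (2 * n)
      * h (- (ln (dist_boundary D (z j)))^-1))%:E < +oo)%E.
Proof.
apply: (@weighted_sum_lty _ (2 * n) (fun j => dist_boundary D (z j))) => //.
- by rewrite muln_gt0.
- by move=> j; rewrite dist_boundary_ge0 z_near_boundary.
- exact: sum_dist_boundary_lty.
Qed.
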